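(* Let $\mathcal{H},\mathcal{H}'$ be Hilbert spaces and let $K:\mathcal{H}\to\mathcal{H}'$ be a bounded linear operator with $\|K\|<1$. Let $(\varphi_\gamma)_{\gamma\in\Gamma}$ be an orthonormal basis of $\mathcal{H}$, let $\Gamma=\Gamma_1\cup\dots\cup\Gamma_n$ (disjoint union), and let $W=(w_\gamma)_{\gamma\in\Gamma}$ be such that for some constant $c>0$ one has $w_\gamma>c$ for all $\gamma\in\Gamma$. Put $W_i=(w_\gamma)_{\gamma\in\Gamma_i}$ and $\mathbf{P}=\{p_1,\dots,p_n\}$ with $1\le p_i\le 2$ for $1\le i\le n$. Assume that either there exists $j$ with $p_j>1$, or $N(K)=\{0\}$. For $g\in\mathcal{H}'$ and $\alpha=(\alpha_1,\dots,\alpha_n)$ with all $\alpha_i\ge 0$, define on $\mathcal{H}$ $$\Phi_{\alpha,W,\mathbf{P};g}(f)=\|Kf-g\|^2+\alpha_1|\!|\!|f|\!|\!|^{p_1}_{W_1,p_1}+\dots+\alpha_n|\!|\!|f|\!|\!|^{p_n}_{W_n,p_n},$$ and let $f^*_{\alpha,W,\mathbf{P};g}$ be the minimizer of $\Phi_{\alpha,W,\mathbf{P};g}$. Let $\alpha(\epsilon)=(\alpha_1(\epsilon),\dots,\alpha_n(\epsilon))$ be such that for all $1\le i,j\le n$ $$\lim_{\epsilon\to0}\alpha_i(\epsilon)=0,\qquad \lim_{\epsilon\to0}\frac{\epsilon^2}{\alpha_i(\epsilon)}=0,\qquad \lim_{\epsilon\to0}\frac{\alpha_i(\epsilon)}{\alpha_j(\epsilon)}=1.$$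 Then, for any $f_0\in\mathcal{H}$, $$\lim_{\epsilon\to0}\Big[\sup_{\|g-Kf_0\|<\epsilon}\|f^*_{\alpha(\epsilon),W,\mathbf{P};g}-f^\dagger\|\Big]=0,$$ where $f^\dagger$ is the unique minimal element with regard to $|\!|\!|\cdot|\!|\!|^{\mathbf{P}}_{W,\mathbf{P}}$ in $S=N(K)+f_0=\{f\in\mathcal{H}: K(f)=K(f_0)\}$.
   Context: For $f\in\mathcal{H}$ write $f_\gamma=\langle f,\varphi_\gamma\rangle$. For $1\le i\le n$, $|\!|\!|f|\!|\!|_{W_i,p_i}=\big(\sum_{\gamma\in\Gamma_i}w_\gamma|f_\gamma|^{p_i}\big)^{1/p_i}$, and $|\!|\!|f|\!|\!|^{\mathbf{P}}_{W,\mathbf{P}}=\sum_{i=1}^n|\!|\!|f|\!|\!|^{p_i}_{W_i,p_i}=\sum_{i=1}^n\sum_{\gamma\in\Gamma_i}w_\gamma|f_\gamma|^{p_i}$. $N(K)$ is the null space of $K$. ''Minimal element with regard to $|\!|\!|\cdot|\!|\!|^{\mathbf{P}}_{W,\mathbf{P}}$ in $S$'' means an element of $S$ at which this functional attains its minimum over $S$. Here $\epsilon>0$ tends to $0$, and the components of $\alpha(\epsilon)$ are nonnegative with all quotients understood to be defined.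
   Formalization: One p_j>1 does not make f† unique, nor need a finite minimum exist: existence is proved if the penalty is finite somewhere on S, uniqueness if all p_i>1 or N(K)={0}, and the limit for every f† that is the unique minimal element of S with finite penalty. *)

(* Defs.v *)
From HB Require Import structures.
From mathcomp Require Import all_boot all_order all_algebra.
From mathcomp Require Import complex.
From mathcomp Require Import all_classical all_reals all_analysis.

Set Implicit Arguments.
Unset Strict Implicit.
Unset Printing Implicit Defensive.

Import Order.TTheory GRing.Theory Num.Theory.
Import numFieldNormedType.Exports.

Local Open Scope classical_set_scope.
Local Open Scope ring_scope.

(* A Hilbert space is over the reals or over the complex numbers. Both cases
   are treated at once: [ground_field R k] is R or R[i] according to [k]. *)
Variant ground := RealScalars | ComplexScalars.

Definition ground_field (R : realType) (k : ground) : numFieldType :=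
  match k with
  | RealScalars => R : numFieldType
  | ComplexScalars => R[i] : numFieldType
  end.

Definition conj_scalar (R : realType) (k : ground) :
    ground_field R k -> ground_field R k :=
  match k with
  | RealScalars => fun x => x
  | ComplexScalars => fun z => conjc z
  end.

Definition re_scalar (R : realType) (k : ground) : ground_field R k -> R :=
  match k with
  | RealScalars => fun x => x
  | ComplexScalars => fun z => complex.Re z
  end.

(* The norm of a normed module over [ground_field R k] takes its (real, nonnegative)
   values in [ground_field R k]; these are the same numbers as elements of R. *)
Definition modulus (R : realType) (k : ground) (x : ground_field R k) : R :=
  re_scalar `|x|.

Definition rnorm (R : realType) (k : ground)
    (H : normedModType (ground_field R k)) (x : H) : R :=
  re_scalar `|x|.

(* The complete normed space H is a Hilbert space with inner product [dot],
   linear in its first argument. *)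
Definition hilbert_product (R : realType) (k : ground)
    (H : completeNormedModType (ground_field R k))
    (dot : {dot H for @conj_scalar R k}) : Prop :=
  forall x : H, dot x x = `|x| ^+ 2.

(* Extended-real valued: +oo exactly when T is unbounded. *)
Definition opnorm (R : realType) (k : ground)
    (H H' : normedModType (ground_field R k)) (T : H -> H') : \bar R :=
  ereal_sup [set (rnorm (T f))%:E | f in [set f : H | rnorm f <= 1]].

Definition orthonormal_basis (R : realType) (k : ground)
    (H : completeNormedModType (ground_field R k))
    (dot : {dot H for @conj_scalar R k})
    (Gamma : choiceType) (phi : Gamma -> H) : Prop :=
  (forall a b : Gamma, dot (phi a) (phi b) = (a == b)%:R) /\
  closure [set f : H | exists (s : seq Gamma) (c : Gamma -> ground_field R k),
                         f = \sum_(a <- s) c a *: phi a] = setT.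

(* The value is +oo when the series diverges. *)
Definition wnorm (R : realType) (k : ground)
    (H : completeNormedModType (ground_field R k))
    (dot : {dot H for @conj_scalar R k})
    (Gamma : choiceType) (phi : Gamma -> H)
    (w : Gamma -> R) (A : set Gamma) (p : R) (f : H) : \bar R :=
  ((\esum_(a in A) (w a * modulus (dot f (phi a)) `^ p)%:E) `^ p^-1)%E.

Definition penalty (R : realType) (k : ground)
    (H : completeNormedModType (ground_field R k))
    (dot : {dot H for @conj_scalar R k})
    (Gamma : choiceType) (phi : Gamma -> H)
    (w : Gamma -> R) (n : nat) (G : 'I_n -> set Gamma) (p : 'I_n -> R)
    (f : H) : \bar R :=
  (\sum_(i < n) wnorm dot phi w (G i) (p i) f `^ p i)%E.

Definition Phi (R : realType) (k : ground)
    (H H' : completeNormedModType (ground_field R k))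
    (dot : {dot H for @conj_scalar R k})
    (Gamma : choiceType) (phi : Gamma -> H)
    (w : Gamma -> R) (n : nat) (G : 'I_n -> set Gamma) (p : 'I_n -> R)
    (K : H -> H') (alpha : 'I_n -> R) (g : H') (f : H) : \bar R :=
  ((rnorm (K f - g) ^+ 2)%:E +
   \sum_(i < n) (alpha i)%:E * wnorm dot phi w (G i) (p i) f `^ p i)%E.

(* A minimum is a real number: an element at which F is +oo is not counted as
   a minimizer, even if F is identically +oo on S. *)
Definition minimizer_on (R : realType) (X : Type) (F : X -> \bar R)
    (S : set X) (x : X) : Prop :=
  [/\ S x, F x \is a fin_num & forall y, S y -> (F x <= F y)%E].

Definition unique_minimizer_on (R : realType) (X : Type) (F : X -> \bar R)
    (S : set X) (x : X) : Prop :=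
  minimizer_on F S x /\ forall y, minimizer_on F S y -> y = x.

(* Main.v *)
Require Import Defs.
From HB Require Import structures.
From mathcomp Require Import all_boot all_order all_algebra.
From mathcomp Require Import complex.
From mathcomp Require Import all_classical all_reals all_analysis.
From mathcomp Require Import ring lra.

Set Implicit Arguments.
Unset Strict Implicit.
Unset Printing Implicit Defensive.

Import Order.TTheory GRing.Theory Num.Theory.
Import numFieldNormedType.Exports.

Local Open Scope classical_set_scope.
Local Open Scope ring_scope.

(** The proof is Hilbert space convexity, with nested sequences of closed convex
    sets in the role usually played by weak compactness.

    If C_0, C_1, ... is a decreasing sequence of nonempty closed sets, stable
    under midpoints, with C_0 bounded, then the C_n have a common point
    ([nested_convex_meet]): by the parallelogram law, nearly norm-minimal points
    x_n of C_n form a Cauchy sequence. Applied to sublevel sets this gives the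
    existence of minimizers ([energy_minimizer]), both of the penalty on the
    solution set and of the regularized functionals. It applies because, with
    p_i <= 2, a bound on the penalty bounds the norm. Uniqueness is strict
    convexity of |.|^p for p > 1 ([energy_minimizer_uniq]).

    For the convergence, let P be the minimal value of the penalty on the
    solution set, attained only at x, and let D_n consist of the f with
    ||K f - K f0|| <= 1/(n+1) and penalty at most P + 1/(n+1). These sets are
    closed, convex, bounded and decreasing, and x is their only common point.
    - The diameter of D_n tends to 0. A half-space that misses x meets D_n
      for finitely many n only, so every coordinate of the elements of D_n
      tends uniformly to that of x ([nested_coord_cvg]). Since the penalties are
      also asymptotically at most P, no energy is left for the coordinates
      outside a large finite set, where squares are dominated by p-th powers;
      this upgrades the convergence to the norm ([nested_norm_cvg]).
    - For small epsilon, every regularized solution lies in D_n. Comparing its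
      value with that of x bounds the misfit by epsilon^2 + O(alpha) and the
      penalty by (epsilon^2/alpha + (1 + d) P)/(1 - d), where d measures how far
      the ratios of the alpha_i are from 1 ([regularized_nearly_minimal]).

    The blocks Gamma_i are merged from the start: the sum of the p_i-th powers
    of the block norms is one sum over the whole basis, whose weight and
    exponent depend on the block of the index ([weighted_penalty_energy]). *)

(** * Real and complex scalars, with real-valued modulus *)

Section scalars.
Context (R : realType) (k : ground).
Implicit Types (r s : R) (z y : ground_field R k).

Definition of_real : R -> ground_field R k :=
  match k with
  | RealScalars => fun x => x
  | ComplexScalars => fun x => x%:C%C
  end.

Lemma re_scalarD : {morph @re_scalar R k : y z / y + z}.
Proof. by case: k => // -[a b] [c d]. Qed.

Lemma re_scalarN : {morph @re_scalar R k : z / - z}.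
Proof. by case: k => // -[a b]. Qed.

Lemma re_scalarB : {morph @re_scalar R k : y z / y - z}.
Proof. by move=> y z; rewrite re_scalarD re_scalarN. Qed.

Lemma re_scalar0 : re_scalar (0 : ground_field R k) = 0.
Proof. by case: k. Qed.

Lemma re_scalar1 : re_scalar (1 : ground_field R k) = 1.
Proof. by case: k. Qed.

Lemma re_of_real r : re_scalar (of_real r) = r.
Proof. by rewrite /of_real; case: k. Qed.

Lemma ge0_of_re z : 0 <= z -> of_real (re_scalar z) = z.
Proof.
rewrite /of_real; move: z; case: k => //= -[a b].
by rewrite lecE/= => /andP[/eqP -> _].
Qed.

Lemma of_realM : {morph of_real : r s / r * s}.
Proof. by rewrite /of_real; case: k => //= r s; rewrite rmorphM. Qed.

Lemma of_realD : {morph of_real : r s / r + s}.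
Proof. by rewrite /of_real; case: k => //= r s; rewrite rmorphD. Qed.

Lemma of_real0 : of_real 0 = 0. Proof. by rewrite /of_real; case: k. Qed.

Lemma of_real1 : of_real 1 = 1. Proof. by rewrite /of_real; case: k. Qed.

Lemma of_real_le r s : (of_real r <= of_real s) = (r <= s).
Proof. by rewrite /of_real; case: k => //=; rewrite lecR. Qed.

Lemma of_real_lt r s : (of_real r < of_real s) = (r < s).
Proof. by rewrite /of_real; case: k => //=; rewrite ltcR. Qed.

Lemma re_scalarZ r z : re_scalar (of_real r * z) = r * re_scalar z.
Proof.
by rewrite /of_real; move: z; case: k => //= -[a b] /=; rewrite mul0r subr0.
Qed.

Lemma conj_of_real r : conj_scalar (of_real r) = of_real r.
Proof. by rewrite /of_real; case: k => //=; rewrite oppr0. Qed.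

Lemma normr_modulus z : `|z| = of_real (modulus z).
Proof. by rewrite ge0_of_re. Qed.

Lemma modulus_ge0 z : 0 <= modulus z.
Proof. by rewrite -of_real_le of_real0 -normr_modulus. Qed.

Lemma modulusM : {morph @modulus R k : y z / y * z}.
Proof.
move=> y z; rewrite /modulus normrM !normr_modulus -of_realM.
by rewrite !re_of_real.
Qed.

Lemma modulus_of_real r : 0 <= r -> modulus (of_real r) = r.
Proof.
move=> r0; rewrite /modulus ger0_norm ?re_of_real//.
by rewrite -of_real0 of_real_le.
Qed.

Lemma modulusD y z : modulus (y + z) <= modulus y + modulus z.
Proof.
by rewrite -of_real_le of_realD -!normr_modulus ler_normD.
Qed.

Lemma modulusN z : modulus (- z) = modulus z.
Proof. by rewrite /modulus normrN. Qed.

Lemma modulus_eq0 z : (modulus z == 0) = (z == 0).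
Proof.
rewrite -[RHS]normr_eq0 normr_modulus -[0 in RHS]of_real0.
by rewrite !eq_le !of_real_le.
Qed.

Lemma modulus_dist y z : `|modulus y - modulus z| <= modulus (y - z).
Proof.
have := modulusD (y - z) z; have := modulusD (z - y) y.
rewrite !subrK -opprB modulusN ler_norml; lra.
Qed.

Lemma re_le_modulus z : re_scalar z <= modulus z.
Proof.
rewrite /modulus; move: z; case: k => /=; first exact: ler_norm.
move=> -[a b] /=; rewrite (le_trans (ler_norm a))//.
by rewrite -sqrtr_sqr ler_sqrt ?lerDl ?sqr_ge0// addr_ge0// sqr_ge0.
Qed.

End scalars.

(** Half-spaces are convex, complements of discs are not. A coordinate is kept
    in a disc by keeping it in the half-planes of finitely many directions. *)
Lemma modulus_lt_directions (R : realType) (k : ground) :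
  exists t : seq (ground_field R k), (forall d, d \in t -> modulus d <= 1) /\
  forall (z : ground_field R k) (e : R),
    (forall d, d \in t -> re_scalar (d * z) < e) -> modulus z < 2 * e.
Proof.
case: k.
  exists [:: 1; -1]; split=> [d|z e h].
    by rewrite !inE => /orP[] /eqP ->; rewrite /modulus/= ?normrN normr1.
  have := h 1; have := h (-1); rewrite !inE !eqxx orbT => /(_ isT) + /(_ isT).
  rewrite /= mulN1r mul1r => h1 h2.
  have e0 : 0 < e by lra.
  by rewrite /modulus/= ltr_norml; lra.
exists [:: 1; -1; 'i%C; (- 'i)%C]; split=> [d|[a b] e h].
  rewrite !inE => /or4P[] /eqP ->; rewrite /modulus/= ?oppr0 ?expr0n/=
  ?addr0 ?add0r ?sqrrN ?expr1n ?sqrtr1//.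
have := h 1; have := h (-1); have := h 'i%C; have := h (- 'i)%C.
rewrite !inE !eqxx !orbT => /(_ isT) + /(_ isT) + /(_ isT) + /(_ isT).
rewrite /= => h1 h2 h3 h4.
have e0 : 0 < e by lra.
have a1 : `|a| < e by rewrite ltr_norml; lra.
have b1 : `|b| < e by rewrite ltr_norml; lra.
have -> : 2 * e = Num.sqrt ((2 * e) ^+ 2) by rewrite sqrtr_sqr ger0_norm; lra.
rewrite /modulus/= ltr_sqrt; last by rewrite exprn_gt0; lra.
rewrite -(real_normK (num_real a)) -(real_normK (num_real b)).
have := normr_ge0 a; have := normr_ge0 b.
nra.
Qed.

(** * Real-valued norms, midpoints and nested convex sets *)

Section real_norm.
Context (R : realType) (k : ground) (H : normedModType (ground_field R k)).
Implicit Types (x y : H).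

Lemma normr_rnorm x : `|x| = of_real k (rnorm x).
Proof. by rewrite ge0_of_re. Qed.

Lemma rnorm_ge0 x : 0 <= rnorm x.
Proof. by rewrite -(of_real_le k) of_real0 -normr_rnorm. Qed.

Lemma rnorm0 : rnorm (0 : H) = 0.
Proof. by rewrite /rnorm normr0 re_scalar0. Qed.

Lemma rnorm_eq0 x : rnorm x = 0 -> x = 0.
Proof. by move=> x0; apply/normr0_eq0; rewrite normr_rnorm x0 of_real0. Qed.

Lemma rnormN x : rnorm (- x) = rnorm x.
Proof. by rewrite /rnorm normrN. Qed.

Lemma rnormC x y : rnorm (x - y) = rnorm (y - x).
Proof. by rewrite -rnormN opprB. Qed.

Lemma rnormD x y : rnorm (x + y) <= rnorm x + rnorm y.
Proof. by rewrite -(of_real_le k) of_realD -!normr_rnorm ler_normD. Qed.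

Lemma rnormZ (a : ground_field R k) x : rnorm (a *: x) = modulus a * rnorm x.
Proof.
by rewrite /rnorm normrZ normr_modulus normr_rnorm -of_realM !re_of_real.
Qed.

Lemma rnorm_dist x y : `|rnorm x - rnorm y| <= rnorm (x - y).
Proof.
have := rnormD (x - y) y; have := rnormD (y - x) x.
by rewrite !subrK (rnormC y) ler_norml; lra.
Qed.

Definition midpoint x y := of_real k (2^-1) *: (x + y).

Lemma midpointB x y x' y' :
  midpoint x y - midpoint x' y' = midpoint (x - x') (y - y').
Proof. by rewrite /midpoint -scalerBr opprD addrACA. Qed.

Lemma midpointxx x : midpoint x x = x.
Proof.
rewrite /midpoint -[X in X + X]scale1r -scalerDl scalerA -(of_real1 R k).
by rewrite -of_realD -of_realM mulVf ?of_real1 ?scale1r.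
Qed.

Lemma rnorm_midpoint x y : rnorm (midpoint x y) <= 2^-1 * (rnorm x + rnorm y).
Proof. by rewrite /midpoint rnormZ modulus_of_real// ler_pM2l// rnormD. Qed.

Lemma lipschitz_continuous (h : H -> R) :
  (forall x y, `|h x - h y| <= rnorm (x - y)) -> continuous h.
Proof.
move=> hL x; apply/cvgrPdist_lt => e e0.
have : \forall y \near x, `|x - y| < of_real k e.
  have /cvgrPdist_lt := @cvg_id _ (nbhs x); apply.
  by rewrite -(of_real0 R k) of_real_lt.
by apply: filterS => y; rewrite normr_rnorm of_real_lt; apply: le_lt_trans.
Qed.

Lemma closure_rnorm (A : set H) x (e : R) : 0 < e -> closure A x ->
  exists2 y, A y & rnorm (x - y) < e.
Proof.
move=> e0 Ax; have e'0 : 0 < of_real k e by rewrite -(of_real0 R k) of_real_lt.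
have [y [Ay]] := Ax _ (nbhsx_ballx x _ e'0).
rewrite -ball_normE/= normr_rnorm of_real_lt => ?.
by exists y.
Qed.

End real_norm.

Lemma rnorm_cauchy_cvg (R : realType) (k : ground)
    (H : completeNormedModType (ground_field R k)) (x : nat -> H) :
  (forall e : R, 0 < e ->
    exists N, forall m n, (N <= m)%N -> (N <= n)%N -> rnorm (x m - x n) < e) ->
  cvgn x.
Proof.
move=> xC; apply/cauchy_cvgP/cauchy_ballP => e e0.
have re0 : 0 < re_scalar e by rewrite -(of_real_lt k) of_real0 ge0_of_re ?ltW.
have [N NC] := xC _ re0.
pose T := [set x m | m in [set m | (N <= m)%N]].
exists (T, T) => /=; first by split; exists N => // m Nm; exists m.
move=> [_ _] [[m Nm <-] [n Nn <-]] /=.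
rewrite -ball_normE/= normr_rnorm -(ge0_of_re (ltW e0)) of_real_lt.
exact: NC.
Qed.

Lemma exists_invS_lt (R : realType) (e : R) : 0 < e ->
  exists N : nat, N.+1%:R^-1 < e.
Proof.
move=> e0; have /(cvgr_lt 0) := @cvg_harmonic R.
by move=> /(_ _ e0) [N _ hN]; exists N; apply: (hN N) => /=.
Qed.

Section inner_product.
Context (R : realType) (k : ground)
  (H : completeNormedModType (ground_field R k))
  (dot : {dot H for @conj_scalar R k}) (hdot : hilbert_product dot).
Implicit Types (x y : H).

Lemma re_dotxx x : re_scalar (dot x x) = rnorm x ^+ 2.
Proof.
by rewrite hdot normr_rnorm expr2 -of_realM re_of_real -expr2.
Qed.

Lemma dot_scaler (a : ground_field R k) x y :
  dot x (a *: y) = conj_scalar a * dot x y.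
Proof. by rewrite linearZr_LR. Qed.

Lemma dot_scalel (a : ground_field R k) x y :
  dot (a *: x) y = a * dot x y.
Proof. by rewrite linearZl_LR. Qed.

Lemma dotDl x x' y : dot (x + x') y = dot x y + dot x' y.
Proof. exact: linearDl. Qed.

Lemma dotDr x y y' : dot x (y + y') = dot x y + dot x y'.
Proof. exact: linearDr. Qed.

Lemma dotNl x y : dot (- x) y = - dot x y.
Proof. exact: linearNl. Qed.

Lemma dotNr x y : dot x (- y) = - dot x y.
Proof. exact: linearNr. Qed.

Lemma dot0l x : dot 0 x = 0.
Proof. exact: linear0l. Qed.

Lemma dot0r x : dot x 0 = 0.
Proof. exact: linear0r. Qed.

Lemma parallelogram x y :
  rnorm (x + y) ^+ 2 + rnorm (x - y) ^+ 2 = 2 * (rnorm x ^+ 2 + rnorm y ^+ 2).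
Proof.
rewrite -!re_dotxx !(dotDl, dotDr, dotNl, dotNr) !(re_scalarD, re_scalarN); lra.
Qed.

Lemma dotC x y : dot x y = conj_scalar (dot y x).
Proof.
suff -> : dot x y = (-1) ^+ false * conj_scalar (dot y x) by rewrite mul1r.
by case: dot => f [? ? [h]]; exact: h.
Qed.

Lemma pythagoras x y : dot x y = 0 ->
  rnorm (x + y) ^+ 2 = rnorm x ^+ 2 + rnorm y ^+ 2.
Proof.
move=> xy; have yx : re_scalar (dot y x) = 0.
  rewrite dotC xy -(of_real0 R k) conj_of_real of_real0.
  exact: re_scalar0.
rewrite -!re_dotxx !(dotDl, dotDr) !re_scalarD xy yx re_scalar0; lra.
Qed.

(** Substitute for weak compactness: nearly minimal elements of the sets form a
    Cauchy sequence by the parallelogram law, since midpoints stay inside. *)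
Lemma nested_convex_meet (C : nat -> set H) (B : R) :
  (forall n, closed (C n)) ->
  (forall n x y, C n x -> C n y -> C n (midpoint x y)) ->
  (forall n, C n !=set0) ->
  (forall m n, (m <= n)%N -> C n `<=` C m) ->
  (forall x, C 0%N x -> rnorm x <= B) ->
  exists x, forall n, C n x.
Proof.
move=> Cclosed Cmid C0 Cdecr Cbnd.
pose N n := [set rnorm x ^+ 2 | x in C n].
have N0 n : N n !=set0 by have [x Cx] := C0 n; exists (rnorm x ^+ 2); exists x.
have Nlb n : has_lbound (N n) by exists 0 => _ [x _ <-]; rewrite sqr_ge0.
have Ninf n : has_inf (N n) by split.
pose d n := inf (N n).
have dle n x : C n x -> d n <= rnorm x ^+ 2.
  by move=> Cx; apply: ge_inf => //; exists x.
have d_nd m n : (m <= n)%N -> d m <= d n.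
  move=> mn; apply: lb_le_inf => // _ [x Cx <-].
  exact/dle/(Cdecr _ _ mn).
have dB n : d n <= B ^+ 2.
  have [x Cx] := C0 n; rewrite (le_trans (dle n x Cx))//.
  by rewrite lerXn2r ?nnegrE ?rnorm_ge0//;
    [apply: le_trans (Cbnd x _)|apply: Cbnd]; rewrite ?rnorm_ge0//;
    exact: Cdecr Cx.
have dsup : has_sup (range d).
  by split; [exists (d 0%N); exists 0%N|exists (B ^+ 2) => _ [n _ <-]].
pose L := sup (range d).
have dL n : d n <= L by apply: ub_le_sup; [case: dsup|exists n].
have near_min n : exists x, C n x /\ rnorm x ^+ 2 < d n + n.+1%:R^-1.
  have n0 : 0 < n.+1%:R^-1 :> R by rewrite invr_gt0.
  by have [_ [x Cx <-] xlt] := inf_adherent n0 (Ninf n); exists x.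
have [x xP] := choice near_min.
have x_cvg : cvgn x.
  (* Two points of C N1 with squared norms within e^2/8 of L, whose midpoint has
     squared norm at least L - e^2/8, are at distance less than e. *)
  apply: rnorm_cauchy_cvg => e e0.
  have e1 : 0 < e ^+ 2 / 8 by rewrite divr_gt0 ?exprn_gt0.
  have [_ [N1 _ <-] dN1] := sup_adherent e1 dsup.
  have [N2 N2e] := exists_invS_lt e1.
  exists (maxn N1 N2) => m n; rewrite !geq_max => /andP[m1 m2] /andP[n1 n2].
  have small i : (N2 <= i)%N -> rnorm (x i) ^+ 2 < L + e ^+ 2 / 8.
    move=> i2; have [_ xi] := xP i.
    have iN2 : i.+1%:R^-1 <= N2.+1%:R^-1 :> R.
      by rewrite lef_pV2 ?posrE// ler_nat.
    apply: (lt_le_trans xi); apply: lerD (dL i) _.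
    exact: le_trans iN2 (ltW N2e).
  have CN1 i : (N1 <= i)%N -> C N1 (x i).
    by move=> i1; apply: (Cdecr _ _ i1); case: (xP i).
  have := dle _ _ (Cmid _ _ _ (CN1 _ m1) (CN1 _ n1)).
  rewrite /midpoint rnormZ modulus_of_real// exprMn => dmid.
  rewrite -(@ltr_pXn2r _ 2)// ?nnegrE ?rnorm_ge0 ?ltW//.
  have := parallelogram (x m) (x n).
  have := small _ m2; have := small _ n2.
  move: dN1; rewrite -/L.
  lra.
exists (limn x) => n.
apply: (closed_cvg (C n)) x_cvg => //.
by exists n => // m /= nm; apply: (Cdecr _ _ nm); case: (xP m).
Qed.

End inner_product.

(** * Orthonormal bases *)

Section orthonormal.
Context (R : realType) (k : ground)
  (H : completeNormedModType (ground_field R k))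
  (dot : {dot H for @conj_scalar R k}) (hdot : hilbert_product dot)
  (Gamma : choiceType) (phi : Gamma -> H)
  (phi_basis : orthonormal_basis dot phi).
Implicit Types (f x : H) (a b : Gamma) (s : seq Gamma)
  (z : Gamma -> ground_field R k).

Lemma dot_suml s z x :
  dot (\sum_(a <- s) z a *: phi a) x = \sum_(a <- s) z a * dot (phi a) x.
Proof.
elim: s => [|a s ih]; first by rewrite !big_nil dot0l.
by rewrite !big_cons dotDl dot_scalel ih.
Qed.

Lemma dot_sumr_eq0 s z x : (forall a, a \in s -> dot x (phi a) = 0) ->
  dot x (\sum_(a <- s) z a *: phi a) = 0.
Proof.
move=> x0; rewrite big_seq; elim/big_ind: _ => [||a sa]; first exact: dot0r.
  by move=> y y' xy xy'; rewrite dotDr xy xy' addr0.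
by rewrite dot_scaler x0// mulr0.
Qed.

Lemma dot_sum_basis s z b : uniq s ->
  dot (\sum_(a <- s) z a *: phi a) (phi b) = if b \in s then z b else 0.
Proof.
move=> us; rewrite dot_suml.
have -> : \sum_(a <- s) z a * dot (phi a) (phi b) =
    \sum_(a <- s | a == b) z a.
  rewrite [RHS]big_mkcond; apply: eq_bigr => a _; rewrite phi_basis.1.
  by case: eqP => _; rewrite ?mulr1 ?mulr0.
case: ifPn => bs; last first.
  rewrite big1_seq// => a /andP[/eqP -> bs'].
  by rewrite bs' in bs.
by rewrite -big_filter filter_pred1_uniq// big_seq1.
Qed.

Lemma rnorm_sum_basis s z : uniq s ->
  rnorm (\sum_(a <- s) z a *: phi a) ^+ 2 = \sum_(a <- s) modulus (z a) ^+ 2.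
Proof.
elim: s => [|a s ih]; first by rewrite !big_nil rnorm0 expr0n.
move=> /= /andP[sa us]; rewrite !big_cons (pythagoras hdot) ?ih//.
  rewrite rnormZ exprMn -(re_dotxx hdot) phi_basis.1 eqxx.
  by rewrite re_scalar1 mulr1.
apply: dot_sumr_eq0 => b bs; rewrite dot_scalel phi_basis.1.
case: eqP => [ab|_]; last by rewrite mulr0.
by rewrite ab bs in sa.
Qed.

Lemma bessel_eq s f : uniq s ->
  rnorm f ^+ 2 = rnorm (f - \sum_(a <- s) dot f (phi a) *: phi a) ^+ 2 +
                 \sum_(a <- s) modulus (dot f (phi a)) ^+ 2.
Proof.
move=> us; rewrite -rnorm_sum_basis// -(pythagoras hdot) ?subrK//.
apply: dot_sumr_eq0 => b bs.
by rewrite dotDl dotNl dot_sum_basis// bs subrr.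
Qed.

Lemma bessel s f : uniq s ->
  \sum_(a <- s) modulus (dot f (phi a)) ^+ 2 <= rnorm f ^+ 2.
Proof. by move=> us; rewrite (bessel_eq f us) lerDr sqr_ge0. Qed.

Lemma modulus_coord_le f a : modulus (dot f (phi a)) <= rnorm f.
Proof.
rewrite -(@ler_pXn2r _ 2)// ?nnegrE ?rnorm_ge0 ?modulus_ge0//.
by have := @bessel [:: a] f; rewrite big_seq1; apply.
Qed.

(** Projecting on finitely many basis vectors beats any other approximation
    by them, so density of the finite combinations gives completeness. *)
Lemma rnorm_le_parseval f (M : R) :
  (forall s, uniq s -> \sum_(a <- s) modulus (dot f (phi a)) ^+ 2 <= M) ->
  rnorm f ^+ 2 <= M.
Proof.
move=> hM; apply/ler_addgt0Pr => e e0.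
have : [set: H] f by [].
rewrite -phi_basis.2 => /(@closure_rnorm _ _ _ _ _ (Num.sqrt e)).
rewrite sqrtr_gt0 => /(_ e0)[g [s0 [z ->]] fg].
pose s := undup s0; have us : uniq s by exact: undup_uniq.
rewrite (bessel_eq f us) addrC; apply: lerD; first exact: hM.
set p := \sum_(a <- s) _; set g0 := \sum_(a <- s0) _ in fg.
have fp0 b : b \in s -> dot (f - p) (phi b) = 0.
  by move=> bs; rewrite dotDl dotNl dot_sum_basis// bs subrr.
have : dot (f - p) (p - g0) = 0.
  rewrite dotDr dotNr !dot_sumr_eq0 ?subr0// => a ha; apply: fp0 => //.
  by rewrite mem_undup.
move=> /(pythagoras hdot); rewrite addrA subrK => fpg.
have : rnorm (f - g0) ^+ 2 <= e.
  rewrite -[leRHS](sqr_sqrtr (ltW e0)) lerXn2r ?nnegrE ?rnorm_ge0 ?sqrtr_ge0//.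
  exact: ltW.
by rewrite fpg; apply: le_trans; rewrite lerDl sqr_ge0.
Qed.

Lemma coord_eq0 f : (forall a, dot f (phi a) = 0) -> f = 0.
Proof.
move=> f0; apply/rnorm_eq0/eqP; rewrite -sqrf_eq0 eq_le sqr_ge0 andbT.
apply: rnorm_le_parseval => s us; rewrite big1// => a _.
by rewrite f0 /modulus normr0 re_scalar0 expr0n.
Qed.

Lemma coord_midpoint f g a :
  dot (midpoint f g) (phi a) =
  of_real k 2^-1 * (dot f (phi a) + dot g (phi a)).
Proof. by rewrite dot_scalel dotDl. Qed.

Lemma modulus_coord_continuous a :
  continuous (fun f => modulus (dot f (phi a))).
Proof.
apply: lipschitz_continuous => f g; apply: le_trans (modulus_dist _ _) _.
by rewrite -dotNl -dotDl modulus_coord_le.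
Qed.

Lemma re_coord_continuous (d : ground_field R k) a : modulus d <= 1 ->
  continuous (fun f => re_scalar (d * dot f (phi a))).
Proof.
move=> d1; apply: lipschitz_continuous => f g.
rewrite -re_scalarB -mulrBr -dotNl -dotDl.
have dm : modulus (d * dot (f - g) (phi a)) <= rnorm (f - g).
  rewrite modulusM (le_trans _ (modulus_coord_le _ a))//.
  by rewrite ler_piMl// modulus_ge0.
rewrite ler_norml lerNl -re_scalarN; apply/andP; split.
  by apply: le_trans (re_le_modulus _) _; rewrite modulusN.
exact: le_trans (re_le_modulus _) dm.
Qed.

End orthonormal.

(** * Strict convexity of powers *)

Section powers.
Context (R : realType).
Implicit Types (q x y u B : R).

Lemma powR_normr_continuous q : 0 < q -> continuous (fun t : R => `|t| `^ q).
Proof.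
move=> q0 t; have [->|t0] := eqVneq t 0.
  apply/cvgrPdist_lt => e e0; rewrite normr0 powR0 ?gt_eqF//.
  have d0 : 0 < e `^ q^-1 by rewrite powR_gt0.
  near=> s; rewrite sub0r normrN ger0_norm ?powR_ge0//.
  rewrite -[ltRHS]powRr1 ?ltW// -(mulVf (lt0r_neq0 q0)) powRrM.
  by rewrite gt0_ltr_powR ?nnegrE ?powR_ge0//; near: s; exact: nbhs0_lt.
suff h : {for t, continuous ((fun u : R => u `^ q) \o (fun s : R => `|s|))}.
  exact: h.
apply: continuous_comp; first exact: norm_continuous.
apply/differentiable_continuous/derivable1_diffP/derivable_powR.
by rewrite in_itv/= normr_gt0 t0.
Unshelve. all: by end_near. Qed.

(** Strict Bernoulli inequality. With x = e^s, dividing by e^s turns it into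
    the sum of e^((q-1)s) > 1 + (q-1)s and (q-1)e^(-s) > (q-1)(1-s). *)
Lemma powR_gt_tangent q x : 1 < q -> 0 <= x -> x != 1 ->
  1 + q * (x - 1) < x `^ q.
Proof.
move=> q1; rewrite le_eqVlt => /orP[/eqP <- _|x0 x1].
  by rewrite powR0 ?gt_eqF//; lra.
have s0 : ln x != 0 by rewrite ln_eq0.
have A : 1 + (q - 1) * ln x < expR ((q - 1) * ln x).
  by rewrite expR_gt1Dx// mulf_neq0// subr_eq0 gt_eqF.
have B : 1 - ln x < expR (- ln x) by rewrite expR_gt1Dx// oppr_eq0.
have qB : (q - 1) * (1 - ln x) < (q - 1) * expR (- ln x).
  by rewrite ltr_pM2l// subr_gt0.
have C : q < expR ((q - 1) * ln x) + (q - 1) * expR (- ln x) by lra.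
have : q * x < (expR ((q - 1) * ln x) + (q - 1) * expR (- ln x)) * x.
  by rewrite ltr_pM2r.
rewrite mulrDl -mulrA -[in X in _ * X + _](lnK x0) -[in X in _ + _ * X](lnK x0).
rewrite -!expRD lnK ?posrE// addNr expR0 /powR gt_eqF//.
have -> : (q - 1) * ln x + ln x = q * ln x by ring.
by lra.
Qed.

Lemma powR_midpoint_lt q x y : 1 < q -> 0 <= x -> 0 <= y -> x != y ->
  (2^-1 * (x + y)) `^ q < 2^-1 * (x `^ q + y `^ q).
Proof.
move=> q1 x0 y0 xy; set m := 2^-1 * (x + y).
have m0 : 0 < m.
  rewrite mulr_gt0// lt_neqAle addr_ge0// eq_sym paddr_eq0// andbT.
  by apply/negP => /andP[/eqP x00 /eqP y00]; rewrite x00 y00 eqxx in xy.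
have mu : m != 0 by rewrite gt_eqF.
have tangent z : 0 <= z -> z != m -> m `^ q * (1 + q * (z / m - 1)) < z `^ q.
  move=> z0 zm; rewrite -[in ltRHS](divfK mu z).
  rewrite (@powRM _ (z / m) m) ?divr_ge0 ?(ltW m0)//.
  rewrite [ltRHS]mulrC ltr_pM2l ?powR_gt0// powR_gt_tangent//.
    by rewrite divr_ge0// ltW.
  by apply: contra zm => /eqP /divr1_eq ->.
have := tangent x x0; have := tangent y y0.
have xm : x != m by apply: contra xy => /eqP h; apply/eqP; rewrite /m in h; lra.
have ym : y != m by apply: contra xy => /eqP h; apply/eqP; rewrite /m in h; lra.
move=> /(_ ym) hy /(_ xm) hx.
have : m `^ q * (1 + q * (x / m - 1)) + m `^ q * (1 + q * (y / m - 1)) =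
    2 * m `^ q.
  rewrite -mulrDr.
  have -> : 1 + q * (x / m - 1) + (1 + q * (y / m - 1)) =
    2 + q * ((x + y) / m - 2) by field.
  have -> : (x + y) / m = 2.
    by apply: (mulIf mu); rewrite divfK// /m mulrA divff// mul1r.
  ring.
lra.
Qed.

Lemma powR_midpoint_le q x y : 1 <= q -> 0 <= x -> 0 <= y ->
  (2^-1 * (x + y)) `^ q <= 2^-1 * (x `^ q + y `^ q).
Proof.
move=> + x0 y0; rewrite le_eqVlt => /orP[/eqP <-|q1].
  by rewrite !powRr1// mulr_ge0// addr_ge0.
have [->|xy] := eqVneq x y; last exact/ltW/powR_midpoint_lt.
have -> : 2^-1 * (y + y) = y by field.
by lra.
Qed.

(** This is where exponents at most 2 matter: for u <= 1 the power dominates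
    the square, and larger u are controlled by the bound B. *)
Lemma sqr_le_powR q u B : 1 <= q <= 2 -> 0 <= u -> 1 <= B -> u `^ q <= B ->
  u ^+ 2 <= B * u `^ q.
Proof.
move=> /andP[q1 q2] u0 B1 uB; have [u1|u1] := leP u 1.
  apply: (@le_trans _ _ (u `^ q)); last by rewrite ler_peMl// powR_ge0.
  move: u0; rewrite le_eqVlt => /orP[/eqP <-|u0].
    by rewrite expr0n/= powR_ge0.
  by rewrite -(powR_mulrn 2 (ltW u0)) ger_powR// u0.
have uq : u <= u `^ q by rewrite le1r_powR// ltW.
by rewrite expr2 ler_pM// (le_trans uq).
Qed.

End powers.

Section modulus_powers.
Context (R : realType) (k : ground).
Implicit Types (q : R) (y z : ground_field R k).

Lemma modulus_parallelogram y z :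
  modulus (y + z) ^+ 2 + modulus (y - z) ^+ 2 =
  2 * (modulus y ^+ 2 + modulus z ^+ 2).
Proof.
move: y z; rewrite /modulus; case: k => /= y z.
  by rewrite !real_normK ?num_real//; ring.
case: y z => [a b] [c d] /=.
by rewrite !sqr_sqrtr ?addr_ge0 ?sqr_ge0//; ring.
Qed.

Lemma modulus_midpoint y z :
  modulus (of_real k 2^-1 * (y + z)) = 2^-1 * modulus (y + z).
Proof. by rewrite modulusM modulus_of_real. Qed.

Lemma modulus_powR_midpoint_le q y z : 1 <= q ->
  modulus (of_real k 2^-1 * (y + z)) `^ q <=
  2^-1 * (modulus y `^ q + modulus z `^ q).
Proof.
move=> q1; have q0 : 0 <= q by lra.
rewrite modulus_midpoint.
apply: le_trans (powR_midpoint_le q1 (modulus_ge0 y) (modulus_ge0 z)).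
by rewrite ge0_ler_powR ?nnegrE ?mulr_ge0 ?addr_ge0 ?modulus_ge0// ler_pM2l//
  modulusD.
Qed.

(** Two ways to be strict: different moduli are separated by strict convexity
    of the power, equal moduli by the parallelogram law. *)
Lemma modulus_powR_midpoint_lt q y z : 1 < q -> y != z ->
  modulus (of_real k 2^-1 * (y + z)) `^ q <
  2^-1 * (modulus y `^ q + modulus z `^ q).
Proof.
move=> q1 yz; have q0 : 0 < q by lra.
have [myz|myz] := eqVneq (modulus y) (modulus z); last first.
  rewrite modulus_midpoint.
  apply: le_lt_trans (powR_midpoint_lt q1 _ _ myz); rewrite ?modulus_ge0//.
  by rewrite ge0_ler_powR ?nnegrE ?mulr_ge0 ?addr_ge0 ?modulus_ge0 ?(ltW q0)//
    ler_pM2l// modulusD.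
rewrite modulus_midpoint myz.
have -> : 2^-1 * (modulus z `^ q + modulus z `^ q) = modulus z `^ q by field.
rewrite gt0_ltr_powR ?nnegrE ?mulr_ge0 ?modulus_ge0//.
have := modulus_parallelogram y z; rewrite myz => par.
have d0 : 0 < modulus (y - z) ^+ 2.
  rewrite exprn_gt0// lt_neqAle modulus_ge0 eq_sym modulus_eq0 subr_eq0.
  by rewrite yz.
rewrite -(@ltr_pXn2r _ 2)// ?nnegrE ?mulr_ge0 ?modulus_ge0// exprMn; lra.
Qed.

End modulus_powers.

(** * Weighted power sums of the coordinates *)

Lemma esum_le_realP (R : realType) (I : choiceType) (t : I -> R) (M : R) :
  (\esum_(a in [set: I]) (t a)%:E <= M%:E)%E <->
  forall s, uniq s -> \sum_(a <- s) t a <= M.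
Proof.
split=> [tM s us|tM].
  rewrite -lee_fin -sumEFin fsbig_seq//; apply: le_trans tM.
  by apply: ereal_sup_ubound; exists [set` s].
apply: ge_ereal_sup => _ [A [Afin _] <-].
by rewrite fsbig_finite// sumEFin lee_fin tM// fset_uniq.
Qed.

Section energy.
Context (R : realType) (k : ground)
  (H : completeNormedModType (ground_field R k))
  (dot : {dot H for @conj_scalar R k}) (hdot : hilbert_product dot)
  (Gamma : choiceType) (phi : Gamma -> H)
  (phi_basis : orthonormal_basis dot phi)
  (q : Gamma -> R) (q_range : forall a, 1 <= q a <= 2).
Implicit Types (f g x : H) (a b : Gamma) (s : seq Gamma) (v : Gamma -> R)
  (M c : R) (h : H -> R).

Definition energy_term v f a := v a * modulus (dot f (phi a)) `^ q a.

Definition energy v f : \bar R :=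
  \esum_(a in [set: Gamma]) (energy_term v f a)%:E.

Let q_ge1 a : 1 <= q a. Proof. by case/andP: (q_range a). Qed.

Lemma energy_term_ge0 v f a : 0 <= v a -> 0 <= energy_term v f a.
Proof. by move=> v0; rewrite mulr_ge0// powR_ge0. Qed.

Lemma energy_ge0 v f : (forall a, 0 <= v a) -> (0 <= energy v f)%E.
Proof.
by move=> v0; apply: esum_ge0 => a _; rewrite lee_fin energy_term_ge0.
Qed.

Lemma energy_term_continuous v a : continuous (fun f => energy_term v f a).
Proof.
move=> f; apply: cvgM; first exact: cvg_cst.
have q0 : 0 < q a by apply: lt_le_trans (q_ge1 a).
pose u g := modulus (dot g (phi a)).
have uc : continuous (fun g => u g `^ q a).
  have <- : (fun t : R => `|t| `^ q a) \o u = (fun g => u g `^ q a).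
    by apply/funext => g; rewrite /= ger0_norm ?modulus_ge0.
  move=> g; apply: continuous_comp; last exact: powR_normr_continuous.
  exact: modulus_coord_continuous.
exact: uc.
Qed.

(** Tested on finite sums only, membership becomes a family of inequalities
    between continuous convex functions. *)
Definition sublevel h v M := [set f | ((h f)%:E + energy v f <= M%:E)%E].

Lemma sublevelP h v M f : sublevel h v M f <->
  forall s, uniq s -> h f + \sum_(a <- s) energy_term v f a <= M.
Proof.
rewrite /sublevel/= -leeBrDl// -EFinB; split.
  by move/esum_le_realP => fM s us; rewrite -lerBrDl; exact: fM.
by move=> fM; apply/esum_le_realP => s us; rewrite lerBrDl; exact: fM.
Qed.

Lemma sublevel_closed h v M : continuous h -> closed (sublevel h v M).
Proof.
move=> hc; rewrite (_ : sublevel h v M = \bigcap_(s in [set s | uniq s])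
    (fun f => h f + \sum_(a <- s) energy_term v f a) @^-1` [set r | r <= M]).
  apply: closed_bigI => s _; apply: preimage_closed; last exact: closed_le.
  move=> f _; apply: cvgD; first exact: hc.
  apply: cvg_big => [|a _]; first exact: add_continuous.
  exact: energy_term_continuous.
by apply/seteqP; split=> f; move/sublevelP.
Qed.

Lemma energy_term_midpoint_le v f g a : 0 <= v a ->
  energy_term v (midpoint f g) a <=
  2^-1 * (energy_term v f a + energy_term v g a).
Proof.
move=> v0; rewrite /energy_term coord_midpoint -mulrDr mulrCA ler_wpM2l//.
exact/modulus_powR_midpoint_le/q_ge1.
Qed.

Lemma sublevel_midpoint h v M f g : (forall a, 0 <= v a) ->
  h (midpoint f g) <= 2^-1 * (h f + h g) ->
  sublevel h v M f -> sublevel h v M g -> sublevel h v M (midpoint f g).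
Proof.
move=> v0 hfg /sublevelP fM /sublevelP gM; apply/sublevelP => s us.
have := fM s us; have := gM s us.
have : \sum_(a <- s) energy_term v (midpoint f g) a <=
    2^-1 * (\sum_(a <- s) energy_term v f a + \sum_(a <- s) energy_term v g a).
  rewrite -big_split/= mulr_sumr; apply: ler_sum => a _.
  exact: energy_term_midpoint_le.
lra.
Qed.

(** Since q <= 2, summability of |f_a|^q forces that of |f_a|^2, once the
    terms are bounded. *)
Lemma sublevel_bounded h v c M : 0 < c -> (forall a, c <= v a) ->
  (forall f, 0 <= h f) -> exists B, forall f, sublevel h v M f -> rnorm f <= B.
Proof.
move=> c0 cv h0; pose N := Num.max 1 (M / c).
have N1 : 1 <= N by rewrite le_max lexx.
exists (N + 1) => f /sublevelP fM.
have sum_le s : uniq s -> \sum_(a <- s) modulus (dot f (phi a)) `^ q a <= N.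
  move=> us; rewrite le_max ler_pdivlMr// mulrC; apply/orP; right.
  apply: le_trans (fM s us); rewrite mulr_sumr -[leLHS]add0r lerD//.
  by apply: ler_sum => a _; rewrite ler_wpM2r// powR_ge0.
have term_le a : modulus (dot f (phi a)) `^ q a <= N.
  by have := sum_le [:: a]; rewrite big_seq1; apply.
have fN : rnorm f ^+ 2 <= N * N.
  apply: (rnorm_le_parseval hdot phi_basis) => s us.
  apply: (@le_trans _ _ (\sum_(a <- s) N * modulus (dot f (phi a)) `^ q a)).
    apply: ler_sum => a _.
    exact: sqr_le_powR (q_range a) (modulus_ge0 _) N1 (term_le a).
  by rewrite -mulr_sumr ler_pM2l ?sum_le// (lt_le_trans _ N1).
rewrite -(@ler_pXn2r _ 2)// ?nnegrE ?rnorm_ge0//; last lra.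
by apply: (le_trans fN); rewrite expr2; nra.
Qed.

(** The direct method, with nested sublevel sets in place of weak limits. *)
Lemma energy_minimizer h v c (S : set H) :
  0 < c -> (forall a, c <= v a) ->
  continuous h -> (forall f, 0 <= h f) ->
  (forall f g, h (midpoint f g) <= 2^-1 * (h f + h g)) ->
  closed S -> (forall f g, S f -> S g -> S (midpoint f g)) ->
  (exists2 f, S f & energy v f \is a fin_num) ->
  exists x, minimizer_on (fun f => ((h f)%:E + energy v f)%E) S x.
Proof.
move=> c0 cv hcont h0 hmid Sclosed Smid [f1 Sf1 f1fin].
have v0 a : 0 <= v a by rewrite (le_trans (ltW c0)).
pose J f := ((h f)%:E + energy v f)%E.
have J0 f : (0 <= J f)%E by rewrite adde_ge0 ?lee_fin// energy_ge0.
pose T := [set M | exists2 f, S f & (J f <= M%:E)%E].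
have Tinf : has_inf T.
  split; last by exists 0 => M [f _]; rewrite -lee_fin; apply: le_trans.
  exists (fine (J f1)), f1 => //.
  by rewrite fineK// fin_numD fin_numE/= f1fin.
pose m := inf T.
pose C n := S `&` sublevel h v (m + n.+1%:R^-1).
have [x xC] : exists x, forall n, C n x.
  have [B hB] := @sublevel_bounded h v c (m + 1%:R^-1) c0 cv h0.
  apply: (@nested_convex_meet _ _ _ _ hdot _ B).
  - by move=> n; apply: closedI => //; apply: sublevel_closed.
  - move=> n f g [Sf fM] [Sg gM]; split; first exact: Smid.
    exact: sublevel_midpoint.
  - move=> n; have n0 : 0 < n.+1%:R^-1 :> R by rewrite invr_gt0.
    have [M [f Sf JM] Mlt] := inf_adherent n0 Tinf; exists f; split=> //.
    by apply: le_trans JM _; rewrite lee_fin ltW.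
  - move=> i j ij f [Sf fM]; split=> //; apply: le_trans fM _.
    by rewrite lee_fin lerD2l lef_pV2 ?posrE// ler_nat.
  - by move=> f [_ /hB].
exists x; have Sx : S x by case: (xC 0%N).
have Jx : (J x <= m%:E)%E.
  apply/lee_addgt0Pr => e e0.
  have [N Ne] := exists_invS_lt e0.
  case: (xC N) => _ xN; apply: le_trans xN _.
  by rewrite -EFinD lee_fin lerD2l ltW.
have Jxfin : J x \is a fin_num.
  by rewrite ge0_fin_numE// (le_lt_trans Jx) ?ltry.
split=> // y Sy; have := J0 y; rewrite -/(J _) -/(J y).
case Jy : (J y) => [r| |] // _; last by rewrite leey.
apply: le_trans Jx _; rewrite lee_fin ge_inf//; first by case: Tinf.
by exists y => //; rewrite Jy.
Qed.

(** Strict convexity at a single differing coordinate already lowers the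
    energy of the midpoint. *)
Lemma energy_minimizer_uniq v (S : set H) f g :
  (forall a, 0 < v a) -> (forall a, 1 < q a) ->
  (forall f g, S f -> S g -> S (midpoint f g)) ->
  minimizer_on (energy v) S f -> minimizer_on (energy v) S g -> f = g.
Proof.
move=> v0 q1 Smid [Sf ffin fmin] [Sg gfin gmin].
have fg : energy v f = energy v g.
  by apply/eqP; rewrite eq_le fmin//= gmin.
apply/eqP; rewrite -subr_eq0; apply/eqP.
apply: (coord_eq0 hdot phi_basis) => a; apply/eqP; rewrite dotDl dotNl subr_eq0.
apply/negPn/negP => fga.
have term_lt : energy_term v (midpoint f g) a <
    2^-1 * (energy_term v f a + energy_term v g a).
  rewrite /energy_term coord_midpoint -mulrDr mulrCA ltr_pM2l//.
  exact: modulus_powR_midpoint_lt.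
set d := 2^-1 * (energy_term v f a + energy_term v g a)
       - energy_term v (midpoint f g) a.
have d0 : 0 < d by rewrite subr_gt0.
pose P := fine (energy v f).
have fP : forall s, uniq s -> \sum_(a <- s) energy_term v f a <= P.
  by apply/esum_le_realP; rewrite fineK.
have gP : forall s, uniq s -> \sum_(a <- s) energy_term v g a <= P.
  by apply/esum_le_realP; rewrite /P fg fineK.
suff : (energy v (midpoint f g) <= (P - d)%:E)%E.
  apply/negP; rewrite -ltNge; apply: lt_le_trans (fmin _ (Smid _ _ Sf Sg)).
  by rewrite -[ltRHS]fineK// lte_fin; rewrite -/P; lra.
apply/esum_le_realP => s us.
(* A sum that may or may not contain the coordinate a is first enlarged to
   contain it. *)
pose s' := rem a s.
have as' : a \notin s' by rewrite mem_rem_uniq// !inE eqxx.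
have us' : uniq (a :: s') by rewrite /= as' rem_uniq.
have ss' : \sum_(b <- s) energy_term v (midpoint f g) b <=
    \sum_(b <- a :: s') energy_term v (midpoint f g) b.
  have [sa|sa] := boolP (a \in s).
    by rewrite (perm_big _ (perm_to_rem sa)).
  by rewrite big_cons /s' rem_id// lerDr energy_term_ge0 ?ltW.
apply: (le_trans ss').
have := fP _ us'; have := gP _ us'; rewrite !big_cons.
have : \sum_(b <- s') energy_term v (midpoint f g) b <=
   2^-1 * (\sum_(b <- s') energy_term v f b + \sum_(b <- s') energy_term v g b).
  rewrite -big_split/= mulr_sumr; apply: ler_sum => b _.
  exact/energy_term_midpoint_le/ltW.
rewrite /d; lra.
Qed.

End energy.

(** * Norm convergence along nested convex sets *)

Lemma eventually_all_seq (T : eqType) (s : seq T) (P : T -> nat -> Prop) :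
  (forall a m n, (m <= n)%N -> P a m -> P a n) ->
  (forall a, a \in s -> exists N, P a N) ->
  exists N, forall a, a \in s -> P a N.
Proof.
move=> Pmono; elim: s => [|a s ih] Ps; first by exists 0%N.
have [|N PN] := ih; first by move=> b bs; apply: Ps; rewrite inE bs orbT.
have [M PM] := Ps a (mem_head _ _).
exists (maxn M N) => b; rewrite inE => /orP[/eqP ->|/PN].
  by apply: Pmono PM; rewrite leq_maxl.
by apply: Pmono; rewrite leq_maxr.
Qed.

Section nested_convergence.
Context (R : realType) (k : ground)
  (H : completeNormedModType (ground_field R k))
  (dot : {dot H for @conj_scalar R k}) (hdot : hilbert_product dot)
  (Gamma : choiceType) (phi : Gamma -> H)
  (phi_basis : orthonormal_basis dot phi)
  (D : nat -> set H) (B : R) (x0 : H)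
  (Dclosed : forall n, closed (D n))
  (Dmid : forall n f g, D n f -> D n g -> D n (midpoint f g))
  (Ddecr : forall m n, (m <= n)%N -> D n `<=` D m)
  (Dbnd : forall f, D 0%N f -> rnorm f <= B)
  (Dmeet : forall f, (forall n, D n f) -> f = x0).
Implicit Types (f : H) (a : Gamma) (s : seq Gamma).

(** Otherwise some half-space missing x0 would cut every D n, and the nested
    intersections would have a common point other than x0. *)
Lemma nested_coord_cvg a (e : R) : 0 < e ->
  exists N, forall f, D N f -> modulus (dot f (phi a) - dot x0 (phi a)) < e.
Proof.
move=> e0; have [t [t1 tP]] := modulus_lt_directions R k.
have [N tN] : exists N, forall d, d \in t -> forall f, D N f ->
    re_scalar (d * (dot f (phi a) - dot x0 (phi a))) < e / 2.
  apply: eventually_all_seq => [d m n mn dm f /(Ddecr mn)|d dt].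
    exact: dm.
  apply: contrapT => /forallNP noN.
  pose u f := re_scalar (d * dot f (phi a)).
  pose C n := D n `&` u @^-1` [set r | u x0 + e / 2 <= r].
  have [x xC] : exists x, forall n, C n x.
    apply: (@nested_convex_meet _ _ _ _ hdot C B).
    - move=> n; apply: closedI => //; apply: preimage_closed.
        by move=> f _; apply: re_coord_continuous => //; exact: t1.
      exact: closed_ge.
    - move=> n f g [Df uf] [Dg ug]; split; first exact: Dmid.
      move: uf ug; rewrite /preimage/= {2 4 6}/u coord_midpoint mulrCA.
      by rewrite re_scalarZ mulrDr re_scalarD; lra.
    - move=> n; have /existsNP[f /not_implyP[Df /negP]] := noN n.
      rewrite -leNgt mulrBr re_scalarB => uf; exists f; split=> //.
      by rewrite /preimage/= /u; lra.
    - by move=> m n mn f [/(Ddecr mn)].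
    - by move=> f [/Dbnd].
  have xx0 : x = x0 by apply: Dmeet => n; case: (xC n).
  by have [_] := xC 0%N; rewrite /preimage/= xx0; lra.
exists N => f Df; have -> : e = 2 * (e / 2) by field.
by apply: tP => d dt; exact: tN.
Qed.

Context (q : Gamma -> R) (q_range : forall a, 1 <= q a <= 2)
  (w : Gamma -> R) (c : R) (c0 : 0 < c) (wc : forall a, c <= w a)
  (P : R) (x0P : energy dot phi q w x0 = P%:E)
  (DP : forall e, 0 < e -> exists N, forall f, D N f ->
     (energy dot phi q w f <= (P + e)%:E)%E).

Let term := energy_term dot phi q w.

Lemma nested_term_cvg a (e : R) : 0 < e ->
  exists N, forall f, D N f -> term x0 a - e < term f a.
Proof.
move=> e0; pose u f := modulus (dot f (phi a)).
have q0 : 0 < q a by case/andP: (q_range a); lra.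
have cont : {for u x0, continuous (fun t : R => w a * `|t| `^ q a)}.
  by apply: cvgM; [exact: cvg_cst|exact: powR_normr_continuous].
move/cvgrPdist_lt: cont => /(_ e e0) [d /= d0 dP].
have [N DN] := nested_coord_cvg a d0; exists N => f Df.
have h := dP (u f); rewrite /= !(ger0_norm (modulus_ge0 _)) in h.
have /h : `|u x0 - u f| < d.
  rewrite distrC; apply: le_lt_trans (modulus_dist _ _) (DN f Df).
by rewrite ltr_norml /term/energy_term -/(u f) -/(u x0); lra.
Qed.

(** Coordinatewise convergence together with convergence of the energies gives
    norm convergence: finitely many coordinates carry almost all the energy of
    x0, hence also almost all the energy of a nearby f, and outside them the
    terms are small enough to dominate squares. *)
Lemma nested_norm_cvg (e : R) : 0 < e ->
  exists N, forall f, D N f -> rnorm (f - x0) <= e.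
Proof.
move=> e0.
(* The final estimate: d from the coordinates in F, and, from those outside,
   at most 2 (|f_a|^2 + |x0_a|^2) with both sums at most 3 d / c. *)
have [d [d0 d1 de]] : exists d : R, [/\ 0 < d, 3 * d / c <= 1 &
    d + 12 * d / c <= e ^+ 2].
  have e2 : 0 < e ^+ 2 by rewrite exprn_gt0.
  have cc : 0 < 1 + 12 / c by rewrite addr_gt0// divr_gt0.
  exists (Num.min (c / 3) (e ^+ 2 / (1 + 12 / c))); split.
  - by rewrite lt_min !divr_gt0.
  - rewrite ler_pdivrMr// mul1r mulrC -ler_pdivlMr//.
    by rewrite ge_min lexx.
  - set m := Num.min _ _; have -> : m + 12 * m / c = m * (1 + 12 / c) by ring.
    by rewrite -ler_pdivlMr// ge_min lexx orbT.
have x0_le : forall s, uniq s -> \sum_(a <- s) term x0 a <= P.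
  by apply/esum_le_realP; rewrite -x0P.
have [F uF Fd] : exists2 F, uniq F & P - d < \sum_(a <- F) term x0 a.
  apply: contrapT => noF.
  have : (energy dot phi q w x0 <= (P - d)%:E)%E.
    apply/esum_le_realP => s us; rewrite leNgt; apply/negP => sd.
    by apply: noF; exists s.
  by rewrite x0P lee_fin; lra.
pose l : R := (size F).+1%:R.
have l0 : 0 < l by rewrite ltr0n.
have dl0 : 0 < d / l by rewrite divr_gt0.
have [N1 F1] : exists N, forall a, a \in F -> forall f, D N f ->
    term x0 a - d / l < term f a.
  apply: eventually_all_seq => [a m n mn h f /(Ddecr mn)|a _]; first exact: h.
  exact: nested_term_cvg.
have [N2 F2] : exists N, forall a, a \in F -> forall f, D N f ->
    modulus (dot f (phi a) - dot x0 (phi a)) ^+ 2 <= d / l.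
  apply: eventually_all_seq => [a m n mn h f /(Ddecr mn)|a _]; first exact: h.
  have sd0 : 0 < Num.sqrt (d / l) by rewrite sqrtr_gt0.
  have [N DN] := nested_coord_cvg a sd0; exists N => f /DN fd.
  rewrite -[leRHS](sqr_sqrtr (ltW dl0)).
  rewrite lerXn2r ?nnegrE ?modulus_ge0 ?sqrtr_ge0//.
  exact: ltW.
have [N3 F3] := DP d0.
exists (maxn N1 (maxn N2 N3)) => f Df.
have D1 : D N1 f by apply: Ddecr Df; rewrite leq_maxl.
have D2 : D N2 f by apply: Ddecr Df; rewrite !leq_max leqnn orbT.
have D3 : D N3 f by apply: Ddecr Df; rewrite !leq_max leqnn !orbT.
have /esum_le_realP f_le := F3 _ D3.
have sumF (s : seq Gamma) : uniq s -> {subset s <= F} -> 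
    \sum_(a <- s) d / l <= d.
  move=> us sF; rewrite big_const_seq count_predT iter_addr_0 -mulr_natr.
  rewrite mulrAC ler_pdivrMr// ler_pM2l// ler_nat.
  by apply: leq_trans (uniq_leq_size us sF) _.
have Ff : P - 2 * d < \sum_(a <- F) term f a.
  have : \sum_(a <- F) (term x0 a - d / l) <= \sum_(a <- F) term f a.
    by rewrite big_seq [leRHS]big_seq; apply: ler_sum => a aF; apply/ltW/F1.
  by rewrite sumrB; have := sumF F uF (fun _ => id); lra.
(* If F carries all of P + e' but 3 d, any disjoint finite set carries at most
   3 d; each power there is at most 3 d / c <= 1 and so dominates the square. *)
have tail g e' s : (forall s, uniq s -> \sum_(a <- s) term g a <= P + e') ->
    P + e' - 3 * d <= \sum_(a <- F) term g a ->
    uniq s -> (forall a, a \in s -> a \notin F) ->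
    \sum_(a <- s) modulus (dot g (phi a)) ^+ 2 <= 3 * d / c.
  move=> gP gF.
  have powR_tail s1 : uniq s1 -> (forall a, a \in s1 -> a \notin F) ->
      \sum_(a <- s1) modulus (dot g (phi a)) `^ q a <= 3 * d / c.
    move=> us1 s1F; rewrite ler_pdivlMr// mulrC mulr_sumr.
    apply: (@le_trans _ _ (\sum_(a <- s1) term g a)).
      by apply: ler_sum => a _; rewrite ler_wpM2r// powR_ge0.
    have : uniq (F ++ s1).
      by rewrite cat_uniq uF us1 andbT; apply/hasPn => a /s1F.
    by move/gP; rewrite big_cat/=; lra.
  move=> us sF; apply: le_trans (powR_tail _ us sF).
  rewrite big_seq [leRHS]big_seq; apply: ler_sum => a sa.
  rewrite -[leRHS]mul1r; apply: (sqr_le_powR (q_range a)) => //.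
    exact: modulus_ge0.
  apply: le_trans d1; have := powR_tail [:: a]; rewrite big_seq1; apply => //.
  by move=> b; rewrite inE => /eqP ->; exact: sF.
rewrite -(@ler_pXn2r _ 2)// ?nnegrE ?rnorm_ge0 ?(ltW e0)//.
apply: le_trans de; apply: (rnorm_le_parseval hdot phi_basis) => s us.
rewrite (bigID (mem F))/= -big_filter -[X in _ + X]big_filter lerD//.
  set s1 := seq.filter _ _.
  have s1F : {subset s1 <= F} by move=> a; rewrite mem_filter => /andP[].
  apply: le_trans (sumF s1 (filter_uniq _ us) s1F).
  rewrite big_seq [leRHS]big_seq; apply: ler_sum => a /s1F aF.
  by rewrite dotDl dotNl; exact: F2.
set s2 := seq.filter _ _.
have us2 : uniq s2 := filter_uniq _ us.
have s2F a : a \in s2 -> a \notin F by rewrite mem_filter => /andP[].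
have tf := tail f d s2 f_le _ us2 s2F.
have tx0 := tail x0 0 s2 _ _ us2 s2F.
apply: (@le_trans _ _ (\sum_(a <- s2)
    (2 * modulus (dot f (phi a)) ^+ 2 + 2 * modulus (dot x0 (phi a)) ^+ 2))).
  apply: ler_sum => a _; rewrite dotDl dotNl.
  have := modulus_parallelogram (dot f (phi a)) (dot x0 (phi a)).
  by have := sqr_ge0 (modulus (dot f (phi a) + dot x0 (phi a))); lra.
rewrite big_split/= -!mulr_sumr.
have := tf _; have := tx0 _ _; rewrite addr0 => /(_ x0_le) hx hf.
have := hx _; have := hf _.
have -> : 12 * d / c = 4 * (3 * d / c) by field; rewrite gt_eqF.
move=> /(_ ltac:(lra)) + /(_ ltac:(lra)); lra.
Qed.

End nested_convergence.

(** * The penalty as a single sum over the basis *)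

Lemma opnorm_lt1_contraction (R : realType) (k : ground)
    (H H' : normedModType (ground_field R k)) (K : {linear H -> H'}) :
  (opnorm K < 1)%E -> forall f, rnorm (K f) <= rnorm f.
Proof.
move=> K1 f; have [f0|f0] := eqVneq (rnorm f) 0.
  by rewrite (rnorm_eq0 f0) linear0 !rnorm0.
have fgt0 : 0 < rnorm f by rewrite lt_neqAle eq_sym f0 rnorm_ge0.
have inv0 : 0 <= (rnorm f)^-1 by rewrite invr_ge0 rnorm_ge0.
pose u := of_real k (rnorm f)^-1 *: f.
have Ku : ((rnorm (K u))%:E <= opnorm K)%E.
  apply: ereal_sup_ubound; exists u => //=.
  by rewrite rnormZ modulus_of_real// mulVf.
have := le_lt_trans Ku K1; rewrite lte_fin linearZ/= rnormZ modulus_of_real//.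
by rewrite mulrC ltr_pdivrMr// mul1r => /ltW.
Qed.

Lemma esumZl (R : realType) (I : choiceType) (A : set I) (t : I -> \bar R)
    (r : R) : 0 <= r -> (forall a, (0 <= t a)%E) ->
  (r%:E * (\esum_(a in A) t a) = \esum_(a in A) (r%:E * t a))%E.
Proof.
move=> r0 t0; rewrite /esum -ereal_supZl//; last first.
  by apply/set0P; exists 0%E, set0; [exact: fsets_set0|rewrite fsbig_set0].
congr ereal_sup; rewrite image_comp; apply: eq_imagel => X _ /=.
by rewrite ge0_mule_fsumr.
Qed.

Section weighted_penalty.
Context (R : realType) (k : ground)
  (H : completeNormedModType (ground_field R k))
  (dot : {dot H for @conj_scalar R k})
  (Gamma : choiceType) (phi : Gamma -> H)
  (n : nat) (G : 'I_n -> set Gamma) (Gdisj : trivIset [set: 'I_n] G)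
  (block : Gamma -> 'I_n) (blockP : forall a, G (block a) a)
  (w : Gamma -> R) (w0 : forall a, 0 <= w a)
  (p : 'I_n -> R) (p0 : forall i, 0 < p i).

(** The roots in the block norms cancel against the powers, so that the blocks
    merge into one sum over the whole basis, with weight and exponent depending
    on the block of the index. *)
Lemma weighted_penalty_energy (alpha : 'I_n -> R) f :
  (forall i, 0 <= alpha i) ->
  (\sum_(i < n) (alpha i)%:E * wnorm dot phi w (G i) (p i) f `^ p i =
   energy dot phi (p \o block) (fun a => (alpha (block a) * w a)%R) f)%E.
Proof.
move=> alpha0; pose t i a := w a * modulus (dot f (phi a)) `^ p i.
have t0 i a : 0 <= t i a by rewrite mulr_ge0// powR_ge0.
have blockE i a : G i a -> block a = i.
  by move=> Gia; apply: Gdisj => //; exists a.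
transitivity (\sum_(i < n) \esum_(a in [set: Gamma])
    if a \in G i then (alpha i * t i a)%:E else 0)%E.
  apply: eq_bigr => i _; rewrite /wnorm -poweRrM mulVf ?gt_eqF//.
  rewrite poweRe1; last first.
    by apply: esum_ge0 => a _; rewrite lee_fin t0.
  rewrite esumZl// => [|a]; last by rewrite lee_fin t0.
  by rewrite esum_mkcond.
rewrite -esum_sum; last first.
  by move=> a i _ _; case: ifP => // _; rewrite lee_fin mulr_ge0.
apply: eq_esum => a _; rewrite (bigD1 (block a))//= mem_set//.
rewrite big1 ?adde0 ?mulrA// => i iblock; case: ifPn => // /set_mem /blockE.
by move=> ai; rewrite ai eqxx in iblock.
Qed.

Lemma penalty_energy f :
  penalty dot phi w G p f = energy dot phi (p \o block) w f.
Proof.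
transitivity (\sum_(i < n) 1%:E * wnorm dot phi w (G i) (p i) f `^ p i)%E.
  by apply: eq_bigr => i _; rewrite mul1e.
rewrite (@weighted_penalty_energy (fun=> 1))//.
by congr (energy _ _ _ _ _); apply/funext => a; rewrite mul1r.
Qed.

End weighted_penalty.

(** * Regularized solutions are nearly minimal *)

Section data_misfit.
Context (R : realType) (k : ground)
  (H H' : normedModType (ground_field R k)) (K : {linear H -> H'})
  (Kle : forall f, rnorm (K f) <= rnorm f).
Implicit Types (f g : H) (y : H').

Lemma misfit_continuous y : continuous (fun f => rnorm (K f - y)).
Proof.
apply: lipschitz_continuous => f g; apply: le_trans (rnorm_dist _ _) _.
by rewrite opprB addrA subrK -linearB.
Qed.

Lemma misfit_le_closed y r : closed [set f | rnorm (K f - y) <= r].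
Proof.
rewrite (_ : mkset _ = (fun f => rnorm (K f - y)) @^-1` [set s | s <= r])//.
apply: preimage_closed; last exact: closed_le.
by move=> f _; exact: misfit_continuous.
Qed.

Lemma linear_midpoint f g : K (midpoint f g) = midpoint (K f) (K g).
Proof. by rewrite /midpoint linearZ linearD. Qed.

Lemma misfit_midpoint y f g :
  rnorm (K (midpoint f g) - y) <= 2^-1 * (rnorm (K f - y) + rnorm (K g - y)).
Proof.
by rewrite -{1}(midpointxx y) linear_midpoint midpointB rnorm_midpoint.
Qed.

Lemma misfit_sqr_midpoint y f g : rnorm (K (midpoint f g) - y) ^+ 2 <=
  2^-1 * (rnorm (K f - y) ^+ 2 + rnorm (K g - y) ^+ 2).
Proof.
have := misfit_midpoint y f g; have := rnorm_ge0 (K (midpoint f g) - y).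
set a := rnorm (K _ - y); set b := rnorm _; set c := rnorm _ => a0 abc.
have : a ^+ 2 <= (2^-1 * (b + c)) ^+ 2.
  by rewrite lerXn2r// nnegrE (le_trans a0).
by have := sqr_ge0 (b - c); lra.
Qed.

Lemma misfit_sqr_continuous y : continuous (fun f => rnorm (K f - y) ^+ 2).
Proof.
move=> f; have -> : (fun f => rnorm (K f - y) ^+ 2) =
    (fun f => rnorm (K f - y) * rnorm (K f - y)).
  by apply/funext => g; rewrite expr2.
by apply: cvgM; exact: misfit_continuous.
Qed.

End data_misfit.

Section regularization.
Context (R : realType) (k : ground)
  (H H' : completeNormedModType (ground_field R k))
  (dot : {dot H for @conj_scalar R k}) (hdot : hilbert_product dot)
  (Gamma : choiceType) (phi : Gamma -> H)
  (phi_basis : orthonormal_basis dot phi)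
  (K : {linear H -> H'}) (Kle : forall f, rnorm (K f) <= rnorm f)
  (q : Gamma -> R) (q_range : forall a, 1 <= q a <= 2)
  (w : Gamma -> R) (c : R) (c0 : 0 < c) (wc : forall a, c <= w a)
  (f0 : H).
Implicit Types (f : H) (g : H').

Let E := energy dot phi q.
Let S := [set f | K f = K f0].

Let w0 a : 0 <= w a. Proof. exact: le_trans (ltW c0) (wc a). Qed.

Lemma solution_set_closed : closed S.
Proof.
suff -> : S = [set f | rnorm (K f - K f0) <= 0] by exact: misfit_le_closed.
apply/seteqP; split=> f; rewrite /S/=.
  by move=> ->; rewrite subrr rnorm0.
move=> h; apply/eqP; rewrite -subr_eq0; apply/eqP/rnorm_eq0/le_anti.
by rewrite h rnorm_ge0.
Qed.

Lemma solution_set_midpoint f h : S f -> S h -> S (midpoint f h).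
Proof. by rewrite /S/= linear_midpoint => -> ->; rewrite midpointxx. Qed.

(** The sets that trap the regularized solutions; P is meant to be the minimal
    energy of a solution. *)
Definition nearly_minimal P (n : nat) :=
  [set f | rnorm (K f - K f0) <= n.+1%:R^-1] `&`
  sublevel dot phi q (fun=> 0) w (P + n.+1%:R^-1).

(** A common point of these sets solves the equation and has energy at most P,
    hence is x: the sets are nested around x alone. *)
Lemma nearly_minimal_norm_cvg (P : R) (x : H) :
  unique_minimizer_on (E w) S x -> E w x = P%:E ->
  forall e : R, 0 < e ->
    exists N, forall f, nearly_minimal P N f -> rnorm (f - x) <= e.
Proof.
move=> [[Sx xfin xmin] xuniq] xP.
have invS m n : (m <= n)%N -> n.+1%:R^-1 <= m.+1%:R^-1 :> R.
  by move=> mn; rewrite lef_pV2 ?posrE// ler_nat.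
have [B hB] := @sublevel_bounded _ _ _ _ hdot _ _ phi_basis _ q_range (fun=> 0)
  w c (P + 1%:R^-1) c0 wc (fun=> lexx 0).
apply: (nested_norm_cvg hdot phi_basis (B := B) _ _ _ _ _ q_range c0 wc xP).
- move=> n; apply: closedI; first exact: misfit_le_closed.
  by apply: sublevel_closed => //; move=> f; exact: cvg_cst.
- move=> n f h [/= Kf Ef] [/= Kh Eh]; split; last first.
    by apply: sublevel_midpoint => //; rewrite addr0 mulr0.
  apply: le_trans (misfit_midpoint K (K f0) f h) _.
  by move: Kf Kh; move: (n.+1%:R^-1 : R) => t; lra.
- move=> m n mn f [/= Kf Ef]; split=> /=.
    exact: le_trans Kf (invS _ _ mn).
  by apply: le_trans Ef _; rewrite lee_fin lerD2l invS.
- by move=> f [_ /hB].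
- move=> f fD; apply: xuniq.
  have Sf : S f.
    apply/eqP; rewrite -subr_eq0; apply/eqP/rnorm_eq0/le_anti.
    rewrite rnorm_ge0 andbT; apply/ler_addgt0Pr => e e0; rewrite add0r.
    have [N /ltW Ne] := exists_invS_lt e0; apply: le_trans Ne.
    by case: (fD N).
  have Ef : (E w f <= P%:E)%E.
    apply/lee_addgt0Pr => e e0.
    have [N /ltW Ne] := exists_invS_lt e0; have [_] := fD N.
    rewrite /sublevel/= add0e => /le_trans; apply.
    by rewrite -EFinD lee_fin lerD2l.
  split=> //.
    by rewrite ge0_fin_numE ?energy_ge0// (le_lt_trans Ef) ?ltry.
  by move=> y Sy; apply: le_trans Ef _; rewrite -xP xmin.
- move=> e e0; have [N /ltW Ne] := exists_invS_lt e0; exists N => f [_].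
  by rewrite /sublevel/= add0e => /le_trans; apply; rewrite lee_fin lerD2l.
Qed.

Lemma energy0 v : E v 0 = 0%E.
Proof.
apply: esum1 => a _; rewrite /energy_term dot0l /modulus normr0 re_scalar0.
by rewrite powR0 ?mulr0// gt_eqF//; case/andP: (q_range a); lra.
Qed.

Lemma regularized_minimizer_exists v (c1 : R) g :
  0 < c1 -> (forall a, c1 <= v a) ->
  exists x, minimizer_on
    (fun f => ((rnorm (K f - g) ^+ 2)%:E + E v f)%E) setT x.
Proof.
move=> c10 c1v.
apply: (energy_minimizer hdot phi_basis q_range c10 c1v) => //.
- exact: misfit_sqr_continuous.
- by move=> f; rewrite sqr_ge0.
- exact: misfit_sqr_midpoint.
- by exists 0 => //; rewrite -/(E v 0) energy0.
Qed.

(** Everything follows from the value at f being at most the value at x. The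
    weights v are those of the energy up to a common scale A and a factor
    between 1 - d and 1 + d; the last four inequalities hold for small
    parameters, and split the tolerance 1/(n+1) into the parts that are lost. *)
Lemma regularized_nearly_minimal v g x f (P e A d : R) (n : nat) :
  S x -> E w x = P%:E -> rnorm (g - K f0) < e ->
  minimizer_on (fun f => ((rnorm (K f - g) ^+ 2)%:E + E v f)%E) setT f ->
  0 < A -> 0 <= d <= 2^-1 ->
  (forall a, (1 - d) * A * w a <= v a <= (1 + d) * A * w a) ->
  e <= n.+1%:R^-1 / 2 ->
  e ^+ 2 + 2 * A * P <= (n.+1%:R^-1 / 2) ^+ 2 ->
  e ^+ 2 / A <= n.+1%:R^-1 / 2 ->
  d * (2 * P + n.+1%:R^-1) <= n.+1%:R^-1 / 2 ->
  nearly_minimal P n f.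
Proof.
set t := n.+1%:R^-1 => Sx xP ge [_ _ fmin] A0 /andP[d0 d12] vw et eAt eA dt.
have t0 : 0 < t by rewrite invr_gt0.
have tE : n.+1%:R^-1 = t by [].
clearbody t.
have e0 : 0 < e by apply: le_lt_trans ge; exact: rnorm_ge0.
have P0 : 0 <= P by rewrite -lee_fin -xP energy_ge0.
have xw : forall s, uniq s -> \sum_(a <- s) energy_term dot phi q w x a <= P.
  by apply/esum_le_realP; rewrite -xP.
have xv : (E v x <= ((1 + d) * A * P)%:E)%E.
  apply/esum_le_realP => s us.
  apply: (@le_trans _ _
      ((1 + d) * A * \sum_(a <- s) energy_term dot phi q w x a)).
    rewrite mulr_sumr; apply: ler_sum => a _; rewrite /energy_term mulrA.
    by rewrite ler_wpM2r ?powR_ge0//; case/andP: (vw a).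
  rewrite ler_wpM2l ?xw// mulr_ge0 ?(ltW A0)//; lra.
have ge2 : rnorm (K x - g) ^+ 2 <= e ^+ 2.
  rewrite lerXn2r ?nnegrE ?rnorm_ge0 ?(ltW e0)// Sx.
  by rewrite rnormC ltW.
pose M := e ^+ 2 + (1 + d) * A * P.
have /sublevelP fM : sublevel dot phi q (fun f => rnorm (K f - g) ^+ 2) v M f.
  apply: le_trans (fmin x _) _ => //.
  by rewrite EFinD leeD// lee_fin.
have Me : M <= e ^+ 2 + 2 * A * P.
  by rewrite lerD2l -!mulrA ler_wpM2r ?mulr_ge0 ?(ltW A0)//; lra.
split=> /=.
  have := fM [::] isT; rewrite big_nil addr0 => fg.
  have fgt : rnorm (K f - g) <= t / 2.
    rewrite -(@ler_pXn2r _ 2)// ?nnegrE ?rnorm_ge0 ?divr_ge0 ?(ltW t0)//.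
    by rewrite (le_trans fg)// (le_trans Me).
  have -> : K f - K f0 = (K f - g) + (g - K f0) by rewrite addrA subrK.
  by apply: le_trans (rnormD _ _) _; rewrite tE; lra.
apply/sublevelP => s us; rewrite add0r tE.
set Ew := \sum_(a <- s) _.
have : (1 - d) * A * Ew <= M.
  apply: le_trans (fM s us); rewrite -[leLHS]add0r lerD ?sqr_ge0//.
  rewrite mulr_sumr; apply: ler_sum => a _; rewrite /energy_term mulrA.
  by rewrite ler_wpM2r ?powR_ge0//; case/andP: (vw a).
have -> : M = (e ^+ 2 / A + (1 + d) * P) * A.
  by rewrite /M; field; rewrite gt_eqF.
rewrite mulrAC ler_pM2r// => h.
have d1 : 0 < 1 - d by lra.
by rewrite -(ler_pM2l d1); lra.
Qed.

End regularization.

(** * Convergence of the regularized solutions *)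

Lemma near_forall_ord (T : Type) (F : set_system T) (FF : Filter F) (n : nat)
    (Q : 'I_n -> T -> Prop) :
  (forall i, \forall x \near F, Q i x) -> \forall x \near F, forall i, Q i x.
Proof.
move=> QF; suff : \forall x \near F, forall i, i \in enum 'I_n -> Q i x.
  by apply: filterS => x Qx i; apply: Qx; rewrite mem_enum.
elim: (enum 'I_n) => [|i s ih]; first exact: nearW.
apply: filterS2 (QF i) ih => x Qi Qs j.
by rewrite inE => /orP[/eqP ->|/Qs].
Qed.

Lemma uniform_lower_bound (R : realType) (n : nat) (alpha : 'I_n -> R) :
  (0 < n)%N -> (forall i, 0 < alpha i) ->
  exists2 m, 0 < m & forall i, m <= alpha i.
Proof.
case: n alpha => // n alpha _ alpha0.
have inv0 i : 0 < (alpha i)^-1 by rewrite invr_gt0.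
have le_sum i : (alpha i)^-1 <= \sum_j (alpha j)^-1.
  by rewrite (bigD1 i)//= lerDl sumr_ge0// => j _; exact: ltW.
have sum0 : 0 < \sum_j (alpha j)^-1 by apply: lt_le_trans (le_sum ord0).
exists (\sum_j (alpha j)^-1)^-1; first by rewrite invr_gt0.
by move=> i; rewrite -[leRHS]invrK lef_pV2 ?posrE.
Qed.

Theorem theorem2p20 (R : realType) (k : ground)
    (H H' : completeNormedModType (ground_field R k))
    (dot : {dot H for @conj_scalar R k})
    (dot' : {dot H' for @conj_scalar R k})
    (hdot : hilbert_product dot) (hdot' : hilbert_product dot')
    (K : {linear H -> H'}) (Kbounded : continuous K)
    (Knorm : (opnorm K < 1)%E)
    (Gamma : choiceType) (phi : Gamma -> H)
    (phi_basis : orthonormal_basis dot phi)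
    (n : nat) (n_gt0 : (0 < n)%N)
    (G : 'I_n -> set Gamma)
    (Gcover : \bigcup_(i in [set: 'I_n]) G i = [set: Gamma])
    (Gdisj : trivIset [set: 'I_n] G)
    (w : Gamma -> R) (c : R) (c_gt0 : 0 < c) (w_gtc : forall a, c < w a)
    (p : 'I_n -> R) (p_range : forall i, 1 <= p i <= 2)
    (p_or_K : (exists j, 1 < p j) \/ [set f : H | K f = 0] = [set 0])
    (fstar : ('I_n -> R) -> H' -> H)
    (fstar_min : forall (a : 'I_n -> R) (g : H'),
      (forall i, 0 <= a i) ->
      (exists f, minimizer_on (Phi dot phi w G p K a g) setT f) ->
      minimizer_on (Phi dot phi w G p K a g) setT (fstar a g))
    (alpha : R -> 'I_n -> R)
    (alpha_gt0 : forall e i, 0 < e -> 0 < alpha e i)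
    (alpha_cvg0 : forall i, alpha e i @[e --> 0^'+] --> (0 : R))
    (alpha_slow : forall i, e ^+ 2 / alpha e i @[e --> 0^'+] --> (0 : R))
    (alpha_ratio : forall i j,
      alpha e i / alpha e j @[e --> 0^'+] --> (1 : R))
    (f0 : H) :
  let S := [set f | K f = K f0] in
  let pen := penalty dot phi w G p in
  [/\ (exists2 f, S f & pen f \is a fin_num) ->
        exists f, minimizer_on pen S f,
      (forall i, 1 < p i) \/ [set f : H | K f = 0] = [set 0] ->
        forall f h, minimizer_on pen S f -> minimizer_on pen S h -> f = h
    & forall fdag : H, unique_minimizer_on pen S fdag ->
        ereal_sup [set (rnorm (fstar (alpha e) g - fdag))%:E
                  | g in [set g : H' | rnorm (g - K f0) < e]]
          @[e --> 0^'+] --> (0%:E : \bar R)].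
Proof.
move=> S pen.
have Kle := opnorm_lt1_contraction Knorm.
have /choice[block blockP] : forall a, exists i, G i a.
  by move=> a; have [i _ Gia] : (\bigcup_(i in [set: 'I_n]) G i) a;
    [rewrite Gcover|exists i].
have w0 a : 0 <= w a by rewrite (le_trans (ltW c_gt0))// ltW.
have wc a : c <= w a by exact: ltW.
have p0 i : 0 < p i by case/andP: (p_range i); lra.
pose q := p \o block.
have q_range a : 1 <= q a <= 2 by exact: p_range.
have penE : pen = energy dot phi q w.
  by apply/funext => f; exact: penalty_energy.
have Sclosed : closed S by exact: solution_set_closed.
have Smid f h : S f -> S h -> S (midpoint f h) by exact: solution_set_midpoint.
split; rewrite penE.
- move=> Sfin.
  have [||x xmin] := @energy_minimizer _ _ _ _ hdot _ _ phi_basis _ q_range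
    (fun=> 0) w c S c_gt0 wc _ (fun=> lexx 0) _ Sclosed Smid Sfin.
  - by move=> f; exact: cvg_cst.
  - by move=> *; rewrite addr0 mulr0.
  exists x; have -> // : energy dot phi q w =
    (fun f => (0%:E + energy dot phi q w f)%E).
  by apply/funext => f; rewrite add0e.
- move=> [p1|K0] f h fmin hmin.
    apply: (energy_minimizer_uniq hdot phi_basis q_range _ _ Smid fmin hmin).
      by move=> a; exact: lt_le_trans (wc a).
    by move=> a; exact: p1.
  have [[Sf _ _] [Sh _ _]] := (fmin, hmin).
  have : [set f : H | K f = 0] (f - h) by rewrite /= linearB Sf Sh subrr.
  by rewrite K0 => /eqP; rewrite subr_eq0 => /eqP.
move=> x xuniq.
have [[Sx xfin xmin] _] := xuniq.
pose P := fine (energy dot phi q w x).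
have xP : energy dot phi q w x = P%:E by rewrite fineK.
have P0 : 0 <= P by rewrite -lee_fin -xP energy_ge0.
have trapped n0 : \forall e \near 0^'+, forall g, rnorm (g - K f0) < e ->
    nearly_minimal dot phi K q w f0 P n0 (fstar (alpha e) g).
  pose t : R := n0.+1%:R^-1.
  have t0 : 0 < t by rewrite invr_gt0.
  have Pt0 : 0 < 2 * P + t by rewrite ltr_wpDl// mulr_ge0.
  (* The tolerance on the ratios: its multiple by 2 P + t, which is what the
     penalty estimate loses, stays below t / 2. *)
  pose d := Num.min 2^-1 (t / 2 / (2 * P + t)).
  have d0 : 0 < d by rewrite lt_min invr_gt0 ltr0n !divr_gt0.
  have d12 : d <= 2^-1 by rewrite ge_min lexx.
  have dPt : d * (2 * P + t) <= t / 2.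
    by rewrite -ler_pdivlMr// ge_min lexx orbT.
  (* The first parameter serves as the common scale of all of them. *)
  pose i0 := Ordinal n_gt0.
  have A_small : 0 < t ^+ 2 / (16 * (P + 1)).
    by rewrite divr_gt0 ?exprn_gt0// mulr_gt0// ltr_wpDl.
  have t4 : 0 < t / 4 by rewrite divr_gt0.
  have t2 : 0 < t / 2 by rewrite divr_gt0.
  have ratio : \forall e \near 0^'+, forall i,
      `|1 - alpha e i / alpha e i0| < d.
    apply: near_forall_ord => i.
    by have /cvgrPdist_lt := alpha_ratio i i0; apply.
  near=> e.
  have e0 : 0 < e by near: e; exact: nbhs_right_gt.
  have e4 : e < t / 4 by near: e; exact: nbhs_right_lt.
  have A0 : 0 < alpha e i0 by exact: alpha_gt0.
  have Asmall : alpha e i0 < t ^+ 2 / (16 * (P + 1)).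
    by near: e; apply: (cvgr_lt 0).
  have Aslow : e ^+ 2 / alpha e i0 < t / 2.
    by near: e; apply: (cvgr_lt 0).
  have Aratio : forall i, `|1 - alpha e i / alpha e i0| < d.
    by near: e; exact: ratio.
  pose v a := alpha e (block a) * w a.
  have PhiE g : Phi dot phi w G p K (alpha e) g =
      fun f => ((rnorm (K f - g) ^+ 2)%:E + energy dot phi q v f)%E.
    apply/funext => f.
    rewrite /Phi (weighted_penalty_energy dot phi Gdisj blockP)//.
    by move=> i; apply/ltW/alpha_gt0.
  have [m m0 mle] := uniform_lower_bound n_gt0 (fun i => alpha_gt0 e i e0).
  have vm a : m * c <= v a.
    by rewrite ler_pM ?(ltW m0) ?(ltW c_gt0).
  move=> g ge.
  have fmin : minimizer_on
      (fun f => ((rnorm (K f - g) ^+ 2)%:E + energy dot phi q v f)%E) setT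
      (fstar (alpha e) g).
    rewrite -PhiE; apply: fstar_min; first by move=> i; apply/ltW/alpha_gt0.
    rewrite PhiE.
    by apply: (regularized_minimizer_exists hdot phi_basis Kle q_range _ _ vm);
      rewrite mulr_gt0.
  apply: (regularized_nearly_minimal c_gt0 wc Sx xP ge fmin A0 (d := d)) => //.
  - by rewrite (ltW d0).
  - move=> a; have := Aratio (block a); rewrite ltr_distlC.
    move=> /andP[]; rewrite ltr_pdivlMr// ltr_pdivrMr// => lo hi.
    by rewrite /v !ler_wpM2r// ltW.
  - by rewrite -/t; lra.
  - rewrite -/t; have e2 : e ^+ 2 < (t / 4) ^+ 2.
      by rewrite ltrXn2r ?nnegrE ?(ltW e0) ?(ltW t4).
    move: Asmall; rewrite ltr_pdivlMr; last by rewrite mulr_gt0// ltr_wpDl.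
    move: A0 e2; clear; move: (alpha e i0) => A; nra.
  - exact: ltW.
have dist_cvg (d : R) : 0 < d -> \forall e \near 0^'+, (0 <=
    ereal_sup [set (rnorm (fstar (alpha e) g - x))%:E
              | g in [set g : H' | (rnorm (g - K f0) < e)%R]] <= d%:E)%E.
  move=> d0; have [N DN] := nearly_minimal_norm_cvg hdot phi_basis Kle q_range
    c_gt0 wc xuniq xP d0.
  near=> e; apply/andP; split.
    apply: (@le_trans _ _ (rnorm (fstar (alpha e) (K f0) - x))%:E).
      by rewrite lee_fin rnorm_ge0.
    apply: ereal_sup_ubound; exists (K f0) => //=.
    by rewrite subrr rnorm0.
  apply: ge_ereal_sup => _ [g /= ge <-]; rewrite lee_fin; apply: DN.
  by move: g ge; near: e; exact: trapped.
apply/fine_cvgP; split.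
  have := dist_cvg 1 ltr01; apply: filterS => e /andP[e0 e1].
  by rewrite ge0_fin_numE// (le_lt_trans e1) ?ltry.
apply/cvgrPdist_le => d d0; have := dist_cvg d d0.
apply: filterS => e /andP[e0 e1]; rewrite /= sub0r normrN.
have fin : ereal_sup [set (rnorm (fstar (alpha e) g - x))%:E
              | g in [set g : H' | rnorm (g - K f0) < e]] \is a fin_num.
  by rewrite ge0_fin_numE// (le_lt_trans e1) ?ltry.
by rewrite ger0_norm ?fine_ge0// -lee_fin fineK.
Unshelve. all: by end_near. Qed.
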